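(* Let $U\subset\mathbb{RP}^1\times\mathbb{RP}^1$ be a connected dense open subset, and let $\mathrm{g}=\mathrm{g}(x,y)\,dx\,dy$ be a smooth Lorentz metric on $U$, where $x,y$ are the standard affine coordinates on the two factors and the function $\mathrm{g}(x,y)$ is positive. For an orientation-preserving diffeomorphism $f:\mathbb{RP}^1\to\mathbb{RP}^1$, regard the graph $y=f(x)$ (wherever it lies in $U$) as a time-like curve, with curvature $\varrho$ and Lorentz arc-length (proper time) $t$. Then the equality of quadratic differentials $$d\varrho\,dt=S(f)$$ holds (at every $x$ with $(x,f(x))\in U$) for every orientation-preserving diffeomorphism $f$ of $\mathbb{RP}^1$ if and only if there exist real constants $a,b,c,d$, not all zero, such that on $U$ $$\mathrm{g}=\frac{dx\,dy}{(axy+bx+cy+d)^2}.$$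
   Context: Diffeomorphisms are smooth. Schwarzian derivative: for a smooth $f$ with $f'\neq 0$, $$S(f)(x)=\frac{f'''(x)}{f'(x)}-\frac32\left(\frac{f''(x)}{f'(x)}\right)^2,$$ and $S(f)$ also denotes the quadratic differential $S(f)(x)\,dx^2$. It is unchanged when $f$ is post-composed with a linear-fractional transformation, and it transforms as a quadratic differential under linear-fractional changes of the variable $x$, so it is well defined on $\mathbb{RP}^1$ for a diffeomorphism $f$ of $\mathbb{RP}^1$. Metric conventions: for a tangent vector $v$ with components $(x',y')$, $\mathrm{g}(v,v)=\mathrm{g}(x,y)\,x'y'$. The surface $2$-form is $\omega=\mathrm{g}(x,y)\,dx\wedge dy$, and $\nabla$ is the Levi-Civita connection of $\mathrm{g}$. A curve $\tau\mapsto(x(\tau),y(\tau))$ with velocity $v$ is time-like if $\mathrm{g}(v,v)>0$. Curvature of a time-like curve: $\varrho=\omega(v,\nabla_v v)\,\mathrm{g}(v,v)^{-3/2}$. Explicitly, $$\varrho=\frac{x'y''-x''y'}{\mathrm{g}^{1/2}(x'y')^{3/2}}-\frac{x'\partial_x\mathrm{g}-y'\partial_y\mathrm{g}}{\mathrm{g}^{3/2}(x'y')^{1/2}}.$$ Arc-length: $dt=\sqrt{\mathrm{g}(v,v)}\,d\tau$. For the graph of $f$, parametrized by $\tau=x$, one has $dt=\sqrt{\mathrm{g}(x,f(x))\,f'(x)}\,dx$, and in the affine coordinate $x$ the equality $d\varrho\,dt=S(f)$ reads $\sqrt{\mathrm{g}(x,f(x))f'(x)}\;\frac{d\varrho}{dx}=S(f)(x)$.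 At points where $x=\infty$ or $f(x)=\infty$ the equality is understood intrinsically, using other affine coordinates obtained by orientation-preserving linear-fractional changes, in which $\mathrm{g}$ is again of the form (positive function) times the product of the coordinate differentials. *)

(* Defs.v *)
From mathcomp Require Import all_boot all_order all_algebra.
From mathcomp Require Import all_classical all_reals all_analysis.

Set Implicit Arguments.
Unset Strict Implicit.
Unset Printing Implicit Defensive.

Import Order.TTheory GRing.Theory Num.Theory.
Import numFieldNormedType.Exports.

Local Open Scope classical_set_scope.
Local Open Scope ring_scope.

(** * The projective line: [Some x] has affine coordinate x, [None] is ∞. *)

Definition RP1 (R : realType) : Type := one_point_compactification R.

(** Two affine coordinates cover RP^1: x itself, and -1/x around ∞.  They are
    related by an orientation-preserving linear-fractional change. *)
Variant chart := AtFinite | AtInfinity.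

Definition in_chart (R : realType) (c : chart) (p : RP1 R) : Prop :=
  match c with
  | AtFinite => p <> None
  | AtInfinity => p <> Some 0
  end.

(** Meaningful only on [in_chart c]; at the one excluded point the value
    is 0. *)
Definition chart_coord (R : realType) (c : chart) (p : RP1 R) : R :=
  match c, p with
  | AtFinite, Some x => x
  | AtFinite, None => 0
  | AtInfinity, Some x => - x^-1
  | AtInfinity, None => 0
  end.

(** The inverse of [chart_coord c], as a map from R onto [in_chart c]. *)
Definition chart_point (R : realType) (c : chart) (u : R) : RP1 R :=
  match c with
  | AtFinite => Some u
  | AtInfinity => if u == 0 then None else Some (- u^-1)
  end.

Definition transition (R : realType) (c c' : chart) (u : R) : R :=
  chart_coord c' (chart_point c u).

Definition local_expr (R : realType) (f : RP1 R -> RP1 R) (c d : chart)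
  (u : R) : R := chart_coord d (f (chart_point c u)).

Definition smooth_map (R : realType) (f : RP1 R -> RP1 R) : Prop :=
  continuous f /\
  forall c d (u : R), in_chart d (f (chart_point c u)) ->
    forall n : nat, derivable (derive1n n (local_expr f c d)) u 1.

Definition diffeomorphism (R : realType) (f : RP1 R -> RP1 R) : Prop :=
  smooth_map f /\
  exists2 finv : RP1 R -> RP1 R,
    cancel f finv /\ cancel finv f & smooth_map finv.

Definition orientation_preserving (R : realType) (f : RP1 R -> RP1 R) : Prop :=
  forall c d (u : R), in_chart d (f (chart_point c u)) ->
    0 < derive1 (local_expr f c d) u.

Definition schwarzian (R : realType) (f : R -> R) (x : R) : R :=
  derive1n 3 f x / derive1 f x
  - 3 / 2 * (derive1n 2 f x / derive1 f x) ^+ 2.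

(** * Functions of two real variables *)

Definition basis_vector (R : realType) (i : 'I_2) : R * R :=
  if i == 0 then (1, 0) else (0, 1).

Definition partial (R : realType) (i : 'I_2) (h : R * R -> R) : R * R -> R :=
  fun p => 'D_(basis_vector R i) h p.

Definition smooth_on (R : realType) (D : set (R * R)) (h : R * R -> R) : Prop :=
  forall (s : seq 'I_2) (p : R * R), D p ->
    differentiable (foldr (@partial R) h s) p.

(** * Lorentz metrics on an open subset of RP^1 x RP^1 *)

Definition coord_domain (R : realType) (U : set (RP1 R * RP1 R))
  (c d : chart) : set (R * R) :=
  [set p | U (chart_point c p.1, chart_point d p.2)].

(** [g c d] is the positive coefficient of the metric with respect to the
    coordinates [c] on the first factor and [d] on the second: the metric reads
    [g c d (u, v) du dv] there.  The last clause is the transformation law of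
    covariant tensors.  Values outside [coord_domain U c d] are irrelevant. *)
Definition lorentz_metric (R : realType) (U : set (RP1 R * RP1 R))
  (g : chart -> chart -> R * R -> R) : Prop :=
  [/\ forall c d, smooth_on (coord_domain U c d) (g c d),
      forall c d p, coord_domain U c d p -> 0 < g c d p &
      forall c d c' d' (u v : R), coord_domain U c d (u, v) ->
        in_chart c' (chart_point c u) -> in_chart d' (chart_point d v) ->
        g c d (u, v) = g c' d' (transition c c' u, transition d d' v)
                       * derive1 (transition c c') u
                       * derive1 (transition d d') v].

(** * Geometry of a metric G(x,y) dx dy in one pair of coordinates

    A curve is given by its two coordinate functions [gam 0] and [gam 1]. *)

(** The convention g(v,v) = G x' y' makes the off-diagonal entries G/2. *)
Definition gram (R : realType) (G : R * R -> R) (p : R * R) : 'M[R]_2 :=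
  \matrix_(i, j) (if i == j then 0 else G p / 2).

Definition metric_form (R : realType) (G : R * R -> R) (p : R * R)
  (v w : 'I_2 -> R) : R := \sum_i \sum_j gram G p i j * v i * w j.

Definition surface_form (R : realType) (G : R * R -> R) (p : R * R)
  (v w : 'I_2 -> R) : R := G p * (v 0 * w 1 - v 1 * w 0).

(** Christoffel symbol of the Levi-Civita connection, upper index [k]. *)
Definition christoffel (R : realType) (G : R * R -> R) (p : R * R)
  (k i j : 'I_2) : R :=
  2^-1 * \sum_l invmx (gram G p) k l *
    (partial i (fun q => gram G q j l) p + partial j (fun q => gram G q i l) p
     - partial l (fun q => gram G q i j) p).

Definition position (R : realType) (gam : 'I_2 -> R -> R) (tau : R) : R * R :=
  (gam 0 tau, gam 1 tau).

Definition velocity (R : realType) (gam : 'I_2 -> R -> R) (tau : R)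
  (i : 'I_2) : R := derive1 (gam i) tau.

(** Components of nabla_v v. *)
Definition acceleration (R : realType) (G : R * R -> R) (gam : 'I_2 -> R -> R)
  (tau : R) (k : 'I_2) : R :=
  derive1n 2 (gam k) tau +
  \sum_i \sum_j christoffel G (position gam tau) k i j *
                velocity gam tau i * velocity gam tau j.

Definition speed2 (R : realType) (G : R * R -> R) (gam : 'I_2 -> R -> R)
  (tau : R) : R :=
  metric_form G (position gam tau) (velocity gam tau) (velocity gam tau).

Definition curvature (R : realType) (G : R * R -> R) (gam : 'I_2 -> R -> R)
  (tau : R) : R :=
  surface_form G (position gam tau) (velocity gam tau) (acceleration G gam tau)
  * speed2 G gam tau `^ (- (3 / 2)).

(** dt/dtau for the proper time t. *)
Definition proper_time_rate (R : realType) (G : R * R -> R)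
  (gam : 'I_2 -> R -> R) (tau : R) : R := Num.sqrt (speed2 G gam tau).

Definition graph_curve (R : realType) (f : R -> R) (i : 'I_2) : R -> R :=
  if i == 0 then id else f.

(** d(rho) dt = S(f), as an equality of coefficients of du^2, at each point of
    the graph of f lying in U and in each pair of coordinates around it. *)
Definition curvature_schwarzian_identity (R : realType)
  (U : set (RP1 R * RP1 R)) (g : chart -> chart -> R * R -> R)
  (f : RP1 R -> RP1 R) : Prop :=
  forall c d (u : R),
    U (chart_point c u, f (chart_point c u)) ->
    in_chart d (f (chart_point c u)) ->
    derive1 (curvature (g c d) (graph_curve (local_expr f c d))) u
      * proper_time_rate (g c d) (graph_curve (local_expr f c d)) u
    = schwarzian (local_expr f c d) u.

(** Homogeneous coordinates (X0, X1), with x = X0/X1, of [chart_point c u].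
    They are normalized so that X1 dX0 - X0 dX1 = du in both coordinates. *)
Definition homog (R : realType) (c : chart) (u : R) : R * R :=
  match c with
  | AtFinite => (u, 1)
  | AtInfinity => (-1, u)
  end.

(** Coefficient of dx dy / (a x y + b x + c y + d)^2 in the coordinates
    [i], [j].  Since dx = (X1 dX0 - X0 dX1) / X1^2, multiplying numerator and
    denominator by (X1 Y1)^2 gives the homogeneous expression below, which also
    makes sense at infinity; for i = j = AtFinite it is
    1 / (a u v + b u + c v + d)^2.  Equality with a positive g forces the
    denominator not to vanish. *)
Definition bilinear_metric (R : realType) (a b c d : R) (i j : chart)
  (p : R * R) : R :=
  let X := homog i p.1 in
  let Y := homog j p.2 in
  1 / (a * X.1 * Y.1 + b * X.1 * Y.2 + c * X.2 * Y.1 + d * X.2 * Y.2) ^+ 2.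

(* Main.v *)
Require Import Defs.
From mathcomp Require Import all_boot all_order all_algebra.
From mathcomp Require Import all_classical all_reals all_analysis.
From mathcomp Require Import ring lra.

Set Implicit Arguments.
Unset Strict Implicit.
Unset Printing Implicit Defensive.

Import Order.TTheory GRing.Theory Num.Theory.
Import numFieldNormedType.Exports.

Local Open Scope classical_set_scope.
Local Open Scope ring_scope.

(** Why the theorem is true.

    Fix coordinates (x, y) in which the metric is G dx dy, write h = G^(-1/2),
    and let y = F(x) be the graph.  The connection of G dx dy has only the two
    Christoffel symbols d_x log G and d_y log G, so the curvature of the graph
    is linear in h:
      rho = h F'' / F'^(3/2) + 2 h_x / F'^(1/2) - 2 h_y F'^(1/2).
    Differentiating, all terms with first derivatives of h cancel, and
    multiplying by dt/dx = F'^(1/2) / h leaves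
      rho' t' - S(F) = (2 / h) (h_xx - F'^2 h_yy + F' (h_xy - h_yx)).
    This is [curvature_defect], written in terms of G: the quantity
    [flex G i] = 3 G_i^2 - 2 G G_ii is 4 G^(5/2) h_ii.

    Sufficiency: when h is the absolute value of a bilinear expression, the
    right-hand side vanishes in each pair of coordinates
    ([bilinear_defect_zero]).

    Necessity: through any point of the surface, and with any slope t > 0 there,
    passes the graph of a projective transformation that is affine in the chosen
    coordinates ([mobius_affine]).  The slopes 1, 2 and 3 separate the three
    terms of the quadratic polynomial in F', so h_xx = h_yy = 0 ([flex_zero]).
    Hence h is affine in each variable separately, that is, bilinear on a box
    ([locally_bilinear]).

    Globalization: the part of the surface at finite distance is in general not
    connected, so the bilinear forms of different boxes are compared on the
    surface itself.  In homogeneous coordinates a bilinear form makes sense at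
    every point and the metric it defines obeys the tensor law
    ([bilinear_metric_change]).  Two forms defining the same metric near one
    point have equal squares, because a biquadratic polynomial vanishing on a
    box is zero ([near_same_square]); so they define the same metric everywhere,
    and the set of points near which a given form is correct is open and closed
    in the connected set U ([bilinear_everywhere]). *)

(** * Derivatives of pointwise expressions *)

Section OneVariable.
Context {R : realType}.
Implicit Types (f g : R -> R) (x : R).

Lemma is_derive1D f g x df dg : is_derive x 1 f df -> is_derive x 1 g dg ->
  is_derive x 1 (fun y => f y + g y) (df + dg).
Proof. exact: is_deriveD. Qed.

Lemma is_derive1B f g x df dg : is_derive x 1 f df -> is_derive x 1 g dg ->
  is_derive x 1 (fun y => f y - g y) (df - dg).
Proof. exact: is_deriveB. Qed.

Lemma is_derive1M f g x df dg : is_derive x 1 f df -> is_derive x 1 g dg ->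
  is_derive x 1 (fun y => f y * g y) (df * g x + f x * dg).
Proof.
move=> hf hg; apply: (is_derive_eq (is_deriveM hf hg)).
by rewrite /GRing.scale /= addrC [df * _]mulrC.
Qed.

Lemma is_derive1V f x df : f x != 0 -> is_derive x 1 f df ->
  is_derive x 1 (fun y => (f y)^-1) (- df / f x ^+ 2).
Proof.
move=> f0 hf; have hv := is_deriveV f0 hf; apply: (is_derive_eq hv).
by rewrite /GRing.scale /= mulNr mulrC -mulNr.
Qed.

Lemma is_derive1_div f g x df dg : g x != 0 ->
  is_derive x 1 f df -> is_derive x 1 g dg ->
  is_derive x 1 (fun y => f y / g y) ((df * g x - f x * dg) / g x ^+ 2).
Proof.
move=> g0 hf hg; apply: (is_derive_eq (is_derive1M hf (is_derive1V g0 hg))).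
by field.
Qed.

Lemma is_derive1_sqrt_comp f x df : 0 < f x -> is_derive x 1 f df ->
  is_derive x 1 (fun y => Num.sqrt (f y)) (df / (2 * Num.sqrt (f x))).
Proof.
move=> f0 hf.
apply: (is_derive_eq
  (@is_derive1_comp _ Num.sqrt f x _ _ (is_derive1_sqrt f0) hf)).
by rewrite mulrC.
Qed.

Lemma is_derive_derive1 f x : derivable f x 1 -> is_derive x 1 f (derive1 f x).
Proof. by move=> h; rewrite derive1E; apply: DeriveDef. Qed.

Lemma is_derive1E f x df : is_derive x 1 f df -> derive1 f x = df.
Proof. by move=> h; rewrite derive1E derive_val. Qed.

Lemma near_derive1 f g x : (\near x, f x = g x) -> derive1 f x = derive1 g x.
Proof. by move=> h; rewrite !derive1E; apply: near_eq_derive. Qed.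

End OneVariable.

(** * Partial derivatives along curves *)

Section Partial.
Context {R : realType}.
Implicit Types (G : R * R -> R).

Lemma is_derive_along G (al be : R -> R) x da db :
  differentiable G (al x, be x) ->
  is_derive x 1 al da -> is_derive x 1 be db ->
  is_derive x 1 (fun t => G (al t, be t))
    (da * partial 0 G (al x, be x) + db * partial 1 G (al x, be x)).
Proof.
move=> hG ha hb.
have al_diff : differentiable al x by apply/derivable1_diffP; exact: ex_derive.
have be_diff : differentiable be x by apply/derivable1_diffP; exact: ex_derive.
have dp : differentiable (fun t => (al t, be t)) x.
  exact: differentiable_pair.
have dc : differentiable (G \o (fun t => (al t, be t))) x.
  exact: differentiable_comp.
have -> : (fun t => G (al t, be t)) = G \o (fun t => (al t, be t)) by [].
apply: DeriveDef; first exact: diff_derivable.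
rewrite deriveE // diff_comp //= diff_pair //= /partial /basis_vector /=.
rewrite !deriveE //.
have -> : 'd al x 1 = da by rewrite -deriveE // derive_val.
have -> : 'd be x 1 = db by rewrite -deriveE // derive_val.
rewrite -[_ * _]/(_ *: _) -[db * _]/(_ *: _) -!linearZ -linearD /=.
by congr ('d G _ (_, _));
  rewrite /= /GRing.scale /= ?mulr1 ?mulr0 ?addr0 ?add0r.
Qed.

Lemma is_derive_fst G x y : differentiable G (x, y) ->
  is_derive x 1 (fun t => G (t, y)) (partial 0 G (x, y)).
Proof.
move=> h; apply: (is_derive_eq (is_derive_along (al := id) (be := cst y) h
  (is_derive_id _ _) (is_derive_cst _ _ _))).
by rewrite mul1r mul0r addr0.
Qed.

Lemma is_derive_snd G x y : differentiable G (x, y) ->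
  is_derive y 1 (fun t => G (x, t)) (partial 1 G (x, y)).
Proof.
move=> h; apply: (is_derive_eq (is_derive_along (al := cst x) (be := id) h
  (is_derive_cst _ _ _) (is_derive_id _ _))).
by rewrite mul1r mul0r add0r.
Qed.

End Partial.

(** * Curvature of a graph for the metric G dx dy *)

Section Curvature.
Context {R : realType}.
Implicit Types (G : R * R -> R) (p : R * R) (F : R -> R).

Lemma ord2P (i : 'I_2) : i = 0 \/ i = 1.
Proof. by case: i => -[|[|//]] hi; [left | right]; exact: val_inj. Qed.

Lemma sum2E (E : 'I_2 -> R) : \sum_i E i = E 0 + E 1.
Proof.
rewrite !big_ord_recl big_ord0 addr0.
by congr (E _ + E _); exact: val_inj.
Qed.

Lemma invmx_gram G p : G p != 0 ->
  invmx (gram G p) = \matrix_(i, j) (if i == j then 0 else 2 / G p).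
Proof.
move=> G0; set B := (X in _ = X).
have AB : gram G p *m B = 1%:M.
  apply/matrixP => i j; rewrite !mxE sum2E !mxE.
  by case: (ord2P i) => ->; case: (ord2P j) => -> /=; field.
have [uA _] := mulmx1_unit AB.
by rewrite -[invmx _]mulmx1 -AB mulmxA mulVmx // mul1mx.
Qed.

Lemma partial_gram G p i k l : differentiable G p ->
  partial i (fun q => gram G q k l) p = if k == l then 0 else partial i G p / 2.
Proof.
move=> dG.
have -> : (fun q => gram G q k l) =
    fun q => if k == l then 0 else G q / 2.
  by apply/funext => q; rewrite mxE.
case: ifP => _; rewrite /partial; first by rewrite derive_cst.
have -> : (fun q => G q / 2) = 2^-1 \*: G.
  by apply/funext => q; rewrite /= mulrC.
by rewrite deriveZ ?[_ *: _]mulrC //; exact: diff_derivable.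
Qed.

Lemma christoffelE G p i j k : differentiable G p -> G p != 0 ->
  christoffel G p k i j =
  if (i == k) && (j == k) then partial k G p / G p else 0.
Proof.
move=> dG G0; rewrite /christoffel invmx_gram // sum2E.
rewrite !partial_gram // !mxE.
by case: (ord2P i) => ->; case: (ord2P j) => ->; case: (ord2P k) => -> /=;
  field.
Qed.

Lemma metric_formE G p v w :
  metric_form G p v w = G p / 2 * (v 0 * w 1 + v 1 * w 0).
Proof.
by rewrite /metric_form !sum2E !mxE /=; ring.
Qed.

Lemma speed2_graph G F u :
  speed2 G (graph_curve F) u = G (u, F u) * derive1 F u.
Proof.
rewrite /speed2 metric_formE /velocity /position /graph_curve /=.
by rewrite derive1_id; field.
Qed.

Lemma acceleration_graph G F u k :
  differentiable G (u, F u) -> G (u, F u) != 0 ->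
  acceleration G (graph_curve F) u k =
  if k == 0 then partial 0 G (u, F u) / G (u, F u)
  else derive1n 2 F u + partial 1 G (u, F u) / G (u, F u) * derive1 F u ^+ 2.
Proof.
move=> dG G0; rewrite /acceleration !sum2E.
have g0 : graph_curve F 0 = id by [].
have g1 : graph_curve F 1 = F by [].
rewrite !christoffelE // /velocity /position !g0 !g1 derive1_id.
have e2 : derive1n 2 (id : R -> R) u = 0.
  rewrite /derive1n /=.
  have -> : derive1 (id : R -> R) = cst 1.
    by apply/funext => x; rewrite derive1_id.
  by rewrite derive1_cst.
case: (ord2P k) => ->.
- by rewrite g0 e2 eqxx /=; field.
- by rewrite g1; move: (derive1n 2 F u) (derive1 F u) => F2 F1 /=; field.
Qed.

Lemma powRN32 (w : R) : 0 < w -> w `^ (- (3 / 2)) = (w * Num.sqrt w)^-1.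
Proof.
move=> w0; rewrite powRN; congr (_^-1).
have -> : 3 / 2 = 1 + 2^-1 :> R by field.
by rewrite powRD ?gt_eqF ?implybT // powRr1 ?ltW // powR12_sqrt // ltW.
Qed.

(** Closed form of the curvature.  It is kept as a quotient by dt/dx so that its
    derivative, once multiplied by dt/dx, no longer contains a square root. *)
Lemma curvature_graph G F u : differentiable G (u, F u) ->
  0 < G (u, F u) -> 0 < derive1 F u ->
  curvature G (graph_curve F) u =
  (derive1n 2 F u / derive1 F u -
    (partial 0 G (u, F u) - derive1 F u * partial 1 G (u, F u)) / G (u, F u))
  / Num.sqrt (G (u, F u) * derive1 F u).
Proof.
move=> dG G0 F0; have w0 : 0 < G (u, F u) * derive1 F u by exact: mulr_gt0.
have Gn : G (u, F u) != 0 by rewrite gt_eqF.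
rewrite /curvature /surface_form !acceleration_graph // speed2_graph powRN32 //.
rewrite /velocity /position; move: (derive1n 2 F u) => F2.
rewrite /graph_curve /= derive1_id.
have s0 : Num.sqrt (G (u, F u) * derive1 F u) != 0.
  by rewrite gt_eqF // sqrtr_gt0.
by field; rewrite s0 !gt_eqF.
Qed.

(** The derivative of n / s, multiplied by s, when s is the square root of w:
    the radical disappears. *)
Lemma quotient_sqrt_derivative (dn n dw w s : R) : s != 0 -> s ^+ 2 = w ->
  (dn * s - n * (dw / (2 * s))) / s ^+ 2 * s = dn - n * dw / (2 * w).
Proof. by move=> s0 <-; field. Qed.

(** The cancellations behind [curvature_defect], with f1, f2, f3 standing for
    the derivatives of F: the third derivative occurs only through the
    Schwarzian, and f2 disappears. *)
Lemma defect_algebra (f1 f2 f3 G Gx Gy Gxx Gxy Gyx Gyy : R) :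
  f1 != 0 -> G != 0 ->
  (f3 * f1 - f2 * f2) / f1 ^+ 2 -
  ((1 * Gxx + f1 * Gxy - (f2 * Gy + f1 * (1 * Gyx + f1 * Gyy))) * G -
    (Gx - f1 * Gy) * (1 * Gx + f1 * Gy)) / G ^+ 2 -
  (f2 / f1 - (Gx - f1 * Gy) / G) * ((1 * Gx + f1 * Gy) * f1 + G * f2) /
    (2 * (G * f1)) -
  (f3 / f1 - 3 / 2 * (f2 / f1) ^+ 2) =
  (3 * Gx ^+ 2 - 2 * G * Gxx - f1 ^+ 2 * (3 * Gy ^+ 2 - 2 * G * Gyy) -
   2 * f1 * G * (Gxy - Gyx)) / (2 * G ^+ 2).
Proof. by move=> f10 G0; field; rewrite f10 G0. Qed.

(** Up to the factor 4 G^(5/2), the second derivative of G^(-1/2) in the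
    direction [i]. *)
Definition flex G i p :=
  3 * partial i G p ^+ 2 - 2 * G p * partial i (partial i G) p.

(** The failure of the identity is a quadratic polynomial in the slope alone:
    the second and third derivatives of F cancel. *)
Lemma curvature_defect (D : set (R * R)) G F u :
  open D -> smooth_on D G -> (forall p, D p -> 0 < G p) ->
  D (u, F u) ->
  (\forall x \near u, forall n, derivable (derive1n n F) x 1) ->
  (\forall x \near u, 0 < derive1 F x) ->
  derive1 (curvature G (graph_curve F)) u * proper_time_rate G (graph_curve F) u
  - schwarzian F u =
  (flex G 0 (u, F u) - derive1 F u ^+ 2 * flex G 1 (u, F u)
   - 2 * derive1 F u * G (u, F u) *
     (partial 1 (partial 0 G) (u, F u) - partial 0 (partial 1 G) (u, F u)))
  / (2 * G (u, F u) ^+ 2).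
Proof.
move=> oD sG G0 Du sF F0.
have sFu n : derivable (derive1n n F) u 1 by move: n; exact: nbhs_singleton sF.
have F0u := nbhs_singleton F0.
have dF : is_derive u 1 F (derive1 F u) := is_derive_derive1 (sFu 0%N).
have dF1 : is_derive u 1 (derive1 F) (derive1n 2 F u).
  exact: (is_derive_derive1 (sFu 1%N)).
have dF2 : is_derive u 1 (derive1n 2 F) (derive1n 3 F u).
  exact: (is_derive_derive1 (sFu 2%N)).
have cgraph : {for u, continuous (fun x => (x, F x))}.
  have F_diff : differentiable F u.
    by apply/derivable1_diffP; exact: (sFu 0%N).
  have id_diff : differentiable (@id R) u by [].
  exact: (differentiable_continuous (differentiable_pair id_diff F_diff)).
have Dn : \forall x \near u, D (x, F x).
  exact: (cgraph D (open_nbhs_nbhs (conj oD Du))).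
have nE : \forall x \near u, curvature G (graph_curve F) x =
    (derive1n 2 F x / derive1 F x -
      (partial 0 G (x, F x) - derive1 F x * partial 1 G (x, F x)) / G (x, F x))
    / Num.sqrt (G (x, F x) * derive1 F x).
  near=> x.
  have Dx : D (x, F x) by near: x.
  rewrite curvature_graph //.
  - exact: (sG [::]).
  - exact: G0.
  - by near: x.
have along H (dH : differentiable H (u, F u)) :=
  is_derive_along dH (is_derive_id u 1) dF.
have dG := along G (sG [::] _ Du).
have dG0 := along (partial 0 G) (sG [:: 0] _ Du).
have dG1 := along (partial 1 G) (sG [:: 1] _ Du).
have Gu := G0 _ Du.
have Gn : G (u, F u) != 0 by rewrite gt_eqF.
have F1n : derive1 F u != 0 by rewrite gt_eqF.
have w0 : 0 < G (u, F u) * derive1 F u by exact: mulr_gt0.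
have s0 : Num.sqrt (G (u, F u) * derive1 F u) != 0.
  by rewrite gt_eqF // sqrtr_gt0.
have dN := is_derive1B (is_derive1_div F1n dF2 dF1)
  (is_derive1_div Gn (is_derive1B dG0 (is_derive1M dF1 dG1)) dG).
have dW := is_derive1_sqrt_comp (f := fun x => G (x, F x) * derive1 F x) w0
  (is_derive1M dG dF1).
have dE := is_derive1_div (g := fun x => Num.sqrt (G (x, F x) * derive1 F x))
  s0 dN dW.
rewrite (near_derive1 nE) (is_derive1E dE).
rewrite /proper_time_rate speed2_graph /schwarzian /flex.
rewrite (quotient_sqrt_derivative _ _ _ s0 (sqr_sqrtr (ltW w0))).
exact: defect_algebra.
Unshelve. all: by end_near. Qed.
End Curvature.

(** * The charts of the projective line *)

Section Charts.
Context {R : realType}.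
Implicit Types (p : RP1 R) (u v x : R) (c d : chart).

Lemma chart_cover p : exists c, in_chart c p.
Proof.
by case: p => [x|]; [exists AtFinite | exists AtInfinity].
Qed.

Lemma in_chart_point c u : in_chart c (chart_point c u).
Proof.
case: c => //=; case: eqP => // /eqP u0 [] /eqP.
by rewrite oppr_eq0 invr_eq0 (negbTE u0).
Qed.

Lemma chart_pointK c u : chart_coord c (chart_point c u) = u.
Proof. by case: c => //=; case: eqP => //= _; rewrite invrN opprK invrK. Qed.

Lemma chart_coordK c p : in_chart c p -> chart_point c (chart_coord c p) = p.
Proof.
case: c; case: p => [x|] //=; last by rewrite eqxx.
move=> x0; have {}x0 : x != 0 by apply: contra_notN x0 => /eqP ->.
by rewrite oppr_eq0 invr_eq0 (negbTE x0) invrN opprK invrK.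
Qed.

Lemma oppr_inv_continuous x : x != 0 -> (fun y : R => - y^-1) @ x --> - x^-1.
Proof. by move=> x0; apply: cvgN; apply: cvgV => //; exact: cvg_id. Qed.

Lemma near_neq x y : x != y -> \forall z \near x, z != y.
Proof.
move=> xy; have : open [set z | z != y :> R] by exact: open_neq.
by move=> /(_ x); apply.
Qed.

Lemma near_in_chart c p : in_chart c p -> \forall q \near p, in_chart c q.
Proof.
case: c; case: p => [x|] //= h.
- by apply: (@filterE _ (nbhs x)).
- have x0 : x != 0 by apply: contra_notN h => /eqP ->.
  have : \forall z \near x, z != 0 by exact: near_neq.
  by apply: filterS => z z0 [] /eqP; rewrite (negbTE z0).
- exists [set 0]; first by split; [exact: compact_set1 | exact: closed_eq].
  by case=> [y|] // [[z z0 [<-]]|//] [zz]; exact: z0.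
Qed.

(** Around the origin of the chart at infinity: a compact subset of the affine
    line is bounded, so it is avoided by -1/u for small u. *)
Lemma chart_point_continuous c : continuous (@chart_point R c).
Proof.
case: c => /= u; first exact: one_point_compactification_some_continuous.
have [->|u0] := eqVneq u 0.
  move=> A hA.
  have : one_point_nbhs (chart_point AtInfinity (0 : R)) A by exact: hA.
  rewrite /= eqxx => -[K [Kc _] KA].
  suff : \forall v \near (0 : R), A (chart_point AtInfinity v) by [].
  have [M [Mr MK]] := compact_bounded Kc.
  pose m := `|M| + 1.
  have m0 : 0 < m by rewrite ltr_wpDl.
  have Mm : M < m by rewrite (le_lt_trans (ler_norm M)) // ltrDl.
  have hm : \forall v \near (0 : R), `|v| < m^-1.
    by apply: nbhs0_lt; rewrite invr_gt0.
  near=> v; apply: KA; rewrite /=; case: eqP => [_|/eqP v0]; [by right | left].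
  exists (- v^-1) => // Kv.
  have := MK _ Mm _ Kv; apply/negP; rewrite -ltNge normrN normfV.
  rewrite -[X in X < _]invrK ltf_pV2 ?posrE ?invr_gt0 ?normr_gt0 //.
  by near: v.
move=> A hA.
have h1 : nbhs (- u^-1) (Some @^-1` A).
  have : one_point_nbhs (chart_point AtInfinity u) A by exact: hA.
  by rewrite /= (negbTE u0).
have h2 : \forall z \near u, A (Some (- z^-1)) := oppr_inv_continuous u0 h1.
suff : \forall v \near u, A (chart_point AtInfinity v) by [].
have : \forall z \near u, z != 0 by exact: near_neq.
move: h2; apply: filterS2 => v /= Av v0.
by rewrite (negbTE v0).
Unshelve. all: by end_near. Qed.

Lemma chart_coord_continuous c p :
  in_chart c p -> {for p, continuous (@chart_coord R c)}.
Proof.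
case: c; case: p => [x|] //= h A.
- by rewrite /= => hA; exact: hA.
- have x0 : x != 0 by apply: contra_notN h => /eqP ->.
  by move=> hA; exact: (oppr_inv_continuous x0 hA).
- rewrite /= => /nbhs_ballP [e /= e0 eA].
  (* outside this segment, 1/x is smaller than e in absolute value *)
  exists [set` `[- e^-1, e^-1]].
    by split; [exact: segment_compact | exact: interval_closed].
  move=> [y|] /= h1; last by apply: eA; exact: ballxx.
  case: h1 => [[z hz [zy]]|//]; rewrite -zy; apply: eA => /=.
  rewrite -ball_normE /= sub0r normrN normrN normfV.
  rewrite -[X in _ < X]invrK ltf_pV2 ?posrE ?invr_gt0 //; last first.
    rewrite normr_gt0; apply/negP => /eqP z0; apply: hz.
    by rewrite z0 /= in_itv /= oppr_le0 invr_ge0 ltW.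
  rewrite ltNge; apply/negP => hh; apply: hz.
  by rewrite /= in_itv /= -ler_norml.
Qed.

(** The hypothesis is on a whole neighborhood because [local_expr] takes the
    value 0 at points that f sends outside the chart [d]. *)
Lemma continuous_at_chart (f : RP1 R -> RP1 R) c d p : in_chart c p ->
  (\forall u \near chart_coord c p, in_chart d (f (chart_point c u))) ->
  {for chart_coord c p, continuous (local_expr f c d)} ->
  {for p, continuous f}.
Proof.
move=> cp hd hl.
have hf : (chart_point d \o local_expr f c d \o chart_coord c) @ p --> f p.
  have -> : f p = (chart_point d \o local_expr f c d \o chart_coord c) p.
    rewrite /= /local_expr chart_coordK // chart_coordK //.
    by have := nbhs_singleton hd; rewrite /= chart_coordK.
  apply: continuous_comp; first exact: chart_coord_continuous.
  by apply: continuous_comp => //; exact: chart_point_continuous.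
move=> A /hf hA; suff : \forall q \near p, A (f q) by [].
have {}hA : \forall q \near p,
  A (chart_point d (local_expr f c d (chart_coord c q))) := hA.
have h1 := near_in_chart cp.
have h2 : \forall q \near p, in_chart d (f (chart_point c (chart_coord c q))).
  exact: (chart_coord_continuous cp hd).
near=> q.
have cq : in_chart c q by near: q.
have dq : in_chart d (f (chart_point c (chart_coord c q))) by near: q.
have : A (chart_point d (local_expr f c d (chart_coord c q))) by near: q.
by rewrite /local_expr chart_coordK // chart_coordK.
Unshelve. all: by end_near. Qed.

End Charts.

(** * Projective transformations *)

Section Mobius.
Context {R : realType}.
Implicit Types (p : RP1 R) (u v x : R) (X : R * R) (c d : chart).

Definition proj X : RP1 R := if X.2 == 0 then None else Some (X.1 / X.2).

Definition homog_of p : R * R := if p is Some x then (x, 1) else (1, 0).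

Definition mobius (al be ga de : R) p : RP1 R :=
  let X := homog_of p in proj (al * X.1 + be * X.2, ga * X.1 + de * X.2).

Lemma proj_homog_of p : proj (homog_of p) = p.
Proof. by case: p => [x|]; rewrite /proj /= ?eqxx ?oner_eq0 ?divr1. Qed.

Lemma proj_scale k X Y : k != 0 -> X.1 = k * Y.1 -> X.2 = k * Y.2 ->
  proj X = proj Y.
Proof.
move=> k0 e1 e2; rewrite /proj e1 e2 mulf_eq0 (negbTE k0) /=.
by case: eqP => // /eqP Y0; congr Some; field; rewrite Y0.
Qed.

Lemma homog_of_proj X : X != 0 ->
  exists2 k, k != 0 & homog_of (proj X) = (k * X.1, k * X.2).
Proof.
case: X => a b X0; rewrite /proj /=; have [b0|b0] := eqVneq b 0.
  have a0 : a != 0 by apply: contra_neq X0 => ->; rewrite b0.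
  by exists a^-1; rewrite ?invr_eq0 // b0 mulVf // mulr0.
by exists b^-1; rewrite ?invr_eq0 //= mulVf // mulrC.
Qed.

Lemma homog_neq0 c u : homog c u != 0.
Proof.
case: c; apply/eqP => -[] /eqP; rewrite ?oppr_eq0 ?oner_eq0 // => _ /eqP.
by rewrite oner_eq0.
Qed.

Lemma homog_of_neq0 p : homog_of p != 0.
Proof.
case: p => [x|]; apply/eqP => -[] /eqP; rewrite ?oner_eq0 // => _ /eqP.
by rewrite oner_eq0.
Qed.

Lemma linear_neq0 (al be ga de : R) X : al * de - be * ga != 0 -> X != 0 ->
  (al * X.1 + be * X.2, ga * X.1 + de * X.2) != 0.
Proof.
case: X => x y D0; apply: contra_neq => -[/= e1 e2].
have f1 : (al * de - be * ga) * x = 0.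
  transitivity (de * (al * x + be * y) - be * (ga * x + de * y)); first by ring.
  by rewrite e1 e2; ring.
have f2 : (al * de - be * ga) * y = 0.
  transitivity (al * (ga * x + de * y) - ga * (al * x + be * y)); first by ring.
  by rewrite e1 e2; ring.
move: f1 f2 => /eqP; rewrite mulf_eq0 (negbTE D0) /= => /eqP ->.
by move=> /eqP; rewrite mulf_eq0 (negbTE D0) /= => /eqP ->.
Qed.

Lemma proj_homog c u : proj (homog c u) = chart_point c u.
Proof.
by case: c; rewrite /proj /= ?oner_eq0 ?divr1 // mulN1r.
Qed.

Lemma mobius_proj al be ga de X : X != 0 ->
  mobius al be ga de (proj X) =
  proj (al * X.1 + be * X.2, ga * X.1 + de * X.2).
Proof.
move=> /homog_of_proj [k k0]; rewrite /mobius => -> /=.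
by apply: (proj_scale k0) => /=; ring.
Qed.

Lemma mobiusK al be ga de : al * de - be * ga != 0 ->
  cancel (mobius al be ga de) (mobius de (- be) (- ga) al).
Proof.
move=> D0 p; rewrite [mobius al be ga de p]/mobius.
set X := homog_of p; rewrite mobius_proj; last first.
  by apply: linear_neq0 => //; exact: homog_of_neq0.
rewrite -[RHS]proj_homog_of -/X; apply: (proj_scale D0) => /=; ring.
Qed.

(** A vanishing denominator gives the value 0, which is also the value of
    [chart_coord] at the point outside the chart. *)
Lemma chart_coord_proj d X : chart_coord d (proj X) =
  match d with AtFinite => X.1 / X.2 | AtInfinity => - (X.2 / X.1) end.
Proof.
case: X => a b; rewrite /proj /=; case: eqP => [->|/eqP b0]; case: d => //=.
- by rewrite invr0 mulr0.
- by rewrite mul0r oppr0.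
- by rewrite invf_div.
Qed.

Lemma in_chart_proj d X : X != 0 -> in_chart d (proj X) <->
  (match d with AtFinite => X.2 | AtInfinity => X.1 end) != 0.
Proof.
case: X => a b X0; rewrite /proj /=; case: eqP => [b0|/eqP b0]; case: d => //=.
- by rewrite b0 eqxx.
- have a0 : a != 0 by apply: contra_neq X0 => ->; rewrite b0.
  by rewrite a0.
- split.
  + by apply: contra_notN => /eqP ->; rewrite mul0r.
  + by move=> a0 [] /eqP; rewrite mulf_eq0 invr_eq0 (negbTE a0) (negbTE b0).
Qed.

Definition homographic (a b c e : R) u := (a * u + b) / (c * u + e).

(** In every pair of charts a projective transformation is given by a single
    fraction with the same determinant, because [homog c u] is (u, 1) up to a
    linear map of determinant 1.  The equality is between total functions. *)
Lemma mobius_local al be ga de c d : al * de - be * ga != 0 ->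
  exists a b k e, [/\ a * e - b * k = al * de - be * ga,
    local_expr (mobius al be ga de) c d = homographic a b k e &
    forall u, in_chart d (mobius al be ga de (chart_point c u)) <->
      k * u + e != 0].
Proof.
move=> D0.
pose Y c u := (al * (homog c u).1 + be * (homog c u).2,
  ga * (homog c u).1 + de * (homog c u).2).
have Y0 u : Y c u != 0 by apply: linear_neq0 => //; exact: homog_neq0.
have mE u : mobius al be ga de (chart_point c u) = proj (Y c u).
  by rewrite -proj_homog mobius_proj // homog_neq0.
suff [a [b [k [e [h1 h2 h3]]]]] : exists a b k e,
    [/\ a * e - b * k = al * de - be * ga,
      forall u, match d with
                | AtFinite => (Y c u).1 / (Y c u).2
                | AtInfinity => - ((Y c u).2 / (Y c u).1)
                end = homographic a b k e u &
      forall u, match d with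
                | AtFinite => (Y c u).2
                | AtInfinity => (Y c u).1
                end = k * u + e].
  exists a, b, k, e; split=> //.
  - by apply/funext => u; rewrite /local_expr mE chart_coord_proj.
  - by move=> u; rewrite mE in_chart_proj // h3.
rewrite /Y /homographic; case: c {Y Y0 mE}; case: d => /=.
- by exists al, be, ga, de; split=> [|u|u]; rewrite ?mulr1.
- exists (- ga), (- de), al, be; split=> [|u|u]; rewrite ?mulr1 //.
    by ring.
  by rewrite -mulNr opprD -mulNr.
- exists be, (- al), de, (- ga); split=> [|u|u]; first by ring.
  + by congr (_ / _); ring.
  + by ring.
- exists (- de), ga, be, (- al); split=> [|u|u]; first by ring.
  + by rewrite -mulNr; congr (_ / _); ring.
  + by ring.
Qed.

(** The graphs used as test curves: every affine function of the coordinates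
    extends to a projective transformation. *)
Lemma mobius_affine c d (t s : R) : exists al be ga de : R,
  al * de - be * ga = t /\
  forall u, mobius al be ga de (chart_point c u) = chart_point d (t * u + s).
Proof.
have E al be ga de u : mobius al be ga de (chart_point c u) =
    proj (al * (homog c u).1 + be * (homog c u).2,
          ga * (homog c u).1 + de * (homog c u).2).
  by rewrite -proj_homog mobius_proj // homog_neq0.
case: c E; case: d => E;
  [exists t, s, 0, 1 | exists 0, (-1), t, s
  | exists (- s), t, (-1), 0 | exists 1, 0, (- s), t];
  (split; [by ring
          | move=> u; rewrite E -proj_homog; congr (proj (_, _)) => /=; ring]).
Qed.

Lemma is_derive_affine (a b u : R) : is_derive u 1 (fun x => a * x + b) a.
Proof.
apply: (is_derive_eq (is_derive1D
  (is_derive1M (is_derive_cst a u 1) (is_derive_id u 1))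
  (is_derive_cst b u 1))).
by rewrite /cst; ring.
Qed.

Lemma near_affine_neq0 (k e u : R) :
  k * u + e != 0 -> \forall x \near u, k * x + e != 0.
Proof.
move=> h.
have hc : {for u, continuous (fun x => k * x + e)}.
  apply: differentiable_continuous; apply/derivable1_diffP.
  exact: (@ex_derive _ _ _ _ _ _ _ (is_derive_affine k e u)).
have h2 : nbhs (k * u + e) [set z | z != 0] by exact: near_neq.
exact: (hc _ h2).
Qed.

Lemma is_derive_homographic (a b k e u : R) : k * u + e != 0 ->
  is_derive u 1 (homographic a b k e) ((a * e - b * k) / (k * u + e) ^+ 2).
Proof.
move=> u0; apply: (is_derive_eq (is_derive1_div (f := fun x => a * x + b)
  (g := fun x => k * x + e) u0 (is_derive_affine a b u)
  (is_derive_affine k e u))).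
by congr (_ / _); ring.
Qed.

Lemma is_derive_affine_powerV (C k e u : R) n : k * u + e != 0 ->
  is_derive u 1 (fun x => C / (k * x + e) ^+ n.+1)
    (- (n.+1%:R * k * C) / (k * u + e) ^+ n.+2).
Proof.
move=> u0.
have dX : is_derive u 1 (fun x => (k * x + e) ^+ n.+1)
    (n.+1%:R * (k * u + e) ^+ n * k).
  have := is_deriveX n.+1 (is_derive_affine k e u).
  by rewrite (_ : (_ ^+ n.+1)%R = fun x => (k * x + e) ^+ n.+1) // exprfctE.
apply: (is_derive_eq (is_derive1_div (g := fun x => (k * x + e) ^+ n.+1)
  (expf_neq0 _ u0) (is_derive_cst C u 1) dX)).
rewrite /cst !exprS; have := expf_neq0 n u0; move: (_ ^+ n) => q q0.
by field; rewrite u0 q0.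
Qed.

Lemma derive1n_homographic (a b k e : R) n :
  exists C : R, forall u, k * u + e != 0 ->
  derive1n n.+1 (homographic a b k e) u = C / (k * u + e) ^+ n.+2.
Proof.
elim: n => [|n [C IH]].
  exists (a * e - b * k) => u u0.
  by rewrite derive1n1 (is_derive1E (is_derive_homographic a b u0)).
exists (- (n.+2%:R * k * C)) => u u0; rewrite derive1nS.
rewrite (near_derive1 (g := fun x => C / (k * x + e) ^+ n.+2)).
  exact: (is_derive1E (is_derive_affine_powerV C n.+1 u0)).
by apply: filterS (near_affine_neq0 u0) => x; exact: IH.
Qed.

Lemma derivable_homographic (a b k e : R) n u : k * u + e != 0 ->
  derivable (derive1n n (homographic a b k e)) u 1.
Proof.
move=> u0; case: n => [|n].
  by have [] := is_derive_homographic a b u0.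
have [C HC] := derive1n_homographic a b k e n.
apply: (@near_eq_derivable _ _ _ (fun x => C / (k * x + e) ^+ n.+2)).
  by apply: filterS (near_affine_neq0 u0) => x /HC.
by have [] := is_derive_affine_powerV C n.+1 u0.
Qed.

Lemma mobius_smooth al be ga de : al * de - be * ga != 0 ->
  smooth_map (mobius al be ga de).
Proof.
move=> D0; split=> [p|c d u].
  have [c cp] := chart_cover p.
  have [d dp] := chart_cover (mobius al be ga de p).
  have [a [b [k [e [hD hE hI]]]]] := mobius_local c d D0.
  have u0 : k * chart_coord c p + e != 0 by apply/hI; rewrite chart_coordK.
  apply: (continuous_at_chart (d := d) cp).
    by apply: filterS (near_affine_neq0 u0) => u; exact: (hI u).2.
  rewrite hE; apply: differentiable_continuous; apply/derivable1_diffP.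
  by have [] := is_derive_homographic a b u0.
have [a [b [k [e [hD hE hI]]]]] := mobius_local c d D0.
by move=> /hI u0 n; rewrite hE; exact: derivable_homographic.
Qed.

Lemma mobius_diffeomorphism al be ga de : al * de - be * ga != 0 ->
  diffeomorphism (mobius al be ga de).
Proof.
move=> D0; split; first exact: mobius_smooth.
have D0' : de * al - (- be) * (- ga) != 0 by rewrite mulrNN mulrC.
exists (mobius de (- be) (- ga) al); last exact: mobius_smooth.
by split; [exact: mobiusK | have := mobiusK D0'; rewrite !opprK].
Qed.

Lemma mobius_orientation_preserving al be ga de : 0 < al * de - be * ga ->
  orientation_preserving (mobius al be ga de).
Proof.
move=> D0 c d u.
have [a [b [k [e [hD -> hI]]]]] := mobius_local c d (lt0r_neq0 D0).
move=> /hI u0.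
rewrite (is_derive1E (is_derive_homographic a b u0)) hD.
by rewrite divr_gt0 // exprn_even_gt0.
Qed.

End Mobius.

(** * Local form of the metric *)

Section Local.
Context {R : realType}.
Implicit Types (u v x y : R) (c d : chart) (G : R * R -> R).

Lemma near_box (D : set (R * R)) u v : open D -> D (u, v) ->
  exists2 e : R, 0 < e & forall x y, `|x - u| < e -> `|y - v| < e -> D (x, y).
Proof.
move=> oD Du.
have /nbhs_ballP [e /= e0 eD] : nbhs (u, v) D by exact: open_nbhs_nbhs.
by exists e => // x y hx hy; apply: eD; split; rewrite /ball /= distrC.
Qed.

Lemma near_fst (D : set (R * R)) u v : open D -> D (u, v) ->
  \forall x \near u, D (x, v).
Proof.
move=> oD /(near_box oD) [e e0 eD].
have : \forall x \near u, `|x - u| < e.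
  by apply/nbhs_ballP; exists e => //= x; rewrite /ball /= distrC.
by apply: filterS => x xu; apply: eD; rewrite ?subrr ?normr0.
Qed.

Lemma near_snd (D : set (R * R)) u v : open D -> D (u, v) ->
  \forall y \near v, D (u, y).
Proof.
move=> oD /(near_box oD) [e e0 eD].
have : \forall y \near v, `|y - v| < e.
  by apply/nbhs_ballP; exists e => //= x; rewrite /ball /= distrC.
by apply: filterS => y yv; apply: eD; rewrite ?subrr ?normr0.
Qed.

Lemma continuous_chart_points c d :
  continuous (fun p : R * R => (chart_point c p.1, chart_point d p.2)).
Proof.
move=> p.
have h1 : {for p, continuous (fun p : R * R => chart_point c p.1)}.
  apply: (@continuous_comp _ _ _ fst (chart_point c)); first exact: cvg_fst.
  exact: chart_point_continuous.
have h2 : {for p, continuous (fun p : R * R => chart_point d p.2)}.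
  apply: (@continuous_comp _ _ _ snd (chart_point d)); first exact: cvg_snd.
  exact: chart_point_continuous.
exact: (cvg_pair h1 h2).
Qed.

Lemma open_coord_domain (U : set (RP1 R * RP1 R)) c d :
  open U -> open (coord_domain U c d).
Proof.
move=> oU; apply: (@open_comp _ _
  (fun p : R * R => (chart_point c p.1, chart_point d p.2))) => // p _.
exact: continuous_chart_points.
Qed.

Lemma chart_defect (U : set (RP1 R * RP1 R)) g f c d u :
  open U -> lorentz_metric U g ->
  diffeomorphism f -> orientation_preserving f ->
  U (chart_point c u, f (chart_point c u)) ->
  in_chart d (f (chart_point c u)) ->
  let F := local_expr f c d in
  let G := g c d in
  derive1 (curvature G (graph_curve F)) u * proper_time_rate G (graph_curve F) u
  - schwarzian F u =
  (flex G 0 (u, F u) - derive1 F u ^+ 2 * flex G 1 (u, F u)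
   - 2 * derive1 F u * G (u, F u) *
     (partial 1 (partial 0 G) (u, F u) - partial 0 (partial 1 G) (u, F u)))
  / (2 * G (u, F u) ^+ 2).
Proof.
move=> oU [sg g0 _] [[cf sf] _] opf Uf df F G.
have dn : \forall x \near u, in_chart d (f (chart_point c x)).
  have h := near_in_chart df.
  have cfc : {for u, continuous (f \o chart_point c)}.
    by apply: continuous_comp; [exact: chart_point_continuous | exact: cf].
  exact: (cfc _ h).
apply: (@curvature_defect _ (coord_domain U c d)).
- exact: open_coord_domain.
- exact: sg.
- exact: g0.
- by rewrite /coord_domain /= /F /local_expr chart_coordK.
- by apply: filterS dn => x /sf.
- by apply: filterS dn => x /opf.
Qed.

(** The numerator of the defect is a quadratic polynomial in the slope t, and
    projective transformations realize every positive t; it vanishes at 1, 2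
    and 3. *)
Lemma flex_zero (U : set (RP1 R * RP1 R)) g c d u v :
  open U -> lorentz_metric U g ->
  (forall f : RP1 R -> RP1 R, diffeomorphism f -> orientation_preserving f ->
     curvature_schwarzian_identity U g f) ->
  coord_domain U c d (u, v) ->
  flex (g c d) 0 (u, v) = 0 /\ flex (g c d) 1 (u, v) = 0.
Proof.
move=> oU gU H Duv.
pose M := partial 1 (partial 0 (g c d)) (u, v)
  - partial 0 (partial 1 (g c d)) (u, v).
have vanish t : 0 < t ->
  flex (g c d) 0 (u, v) - t ^+ 2 * flex (g c d) 1 (u, v)
   - 2 * t * g c d (u, v) * M = 0.
  move=> t0.
  have [al [be [ga [de [hD hf]]]]] := mobius_affine c d t (v - t * u).
  set f := mobius al be ga de in hf.
  have D0 : 0 < al * de - be * ga by rewrite hD.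
  have df : diffeomorphism f by apply: mobius_diffeomorphism; rewrite gt_eqF.
  have opf : orientation_preserving f by exact: mobius_orientation_preserving.
  have fE : local_expr f c d = fun x => t * x + (v - t * u).
    by apply/funext => x; rewrite /local_expr hf chart_pointK.
  have fu : f (chart_point c u) = chart_point d v by rewrite hf addrC subrK.
  have Uf : U (chart_point c u, f (chart_point c u)) by rewrite fu.
  have df_u : in_chart d (f (chart_point c u)).
    by rewrite fu; exact: in_chart_point.
  have := chart_defect oU gU df opf Uf df_u.
  rewrite /= (H f df opf c d u Uf df_u) subrr.
  have -> : derive1 (local_expr f c d) u = t.
    by rewrite fE (is_derive1E (is_derive_affine _ _ _)).
  have -> : local_expr f c d u = v by rewrite fE addrC subrK.
  have [_ g0 _] := gU; have /lt0r_neq0 Gn := g0 c d _ Duv.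
  move=> /esym/eqP; rewrite mulf_eq0 invr_eq0 mulf_eq0 expf_eq0 (negbTE Gn) /=.
  by rewrite pnatr_eq0 /= orbF => /eqP.
have := vanish 1 ltr01.
have := vanish 2 (ltr0Sn _ 1); have := vanish 3 (ltr0Sn _ 2).
move: M {vanish} => M.
move: (flex _ 0 _) (flex _ 1 _) (g c d (u, v)) M => A B C D h3 h2 h1.
have {}h1 : A - B - 2 * (C * D) = 0 by rewrite -h1; ring.
have {}h2 : A - 4 * B - 4 * (C * D) = 0 by rewrite -h2; ring.
have {}h3 : A - 9 * B - 6 * (C * D) = 0 by rewrite -h3; ring.
by move: (C * D) h1 h2 h3 => E h1 h2 h3; split; lra.
Qed.

Lemma zero_derivative_const (f : R -> R) (z e : R) :
  (forall x, `|x - z| < e -> is_derive x 1 f 0) ->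
  forall x, `|x - z| < e -> f x = f z.
Proof.
move=> hf x hx.
have h (a b : R) : a < b -> `|a - z| < e -> `|b - z| < e -> f b = f a.
  move=> ab ha hb.
  have inab y : y \in `[a, b] -> `|y - z| < e.
    rewrite in_itv /= => /andP[ay yb]; move: ha hb; rewrite !ltr_norml.
    by move=> /andP[a1 a2] /andP[b1 b2]; apply/andP; split; lra.
  have [y _] : exists2 c, c \in `]a, b[%R &
      f b - f a = (fun _ => 0) c * (b - a).
    apply: (@MVT _ f (fun _ => 0)) => //.
      by move=> y /subset_itv_oo_cc yab; exact/hf/inab.
    apply: derivable_within_continuous => y yab.
    by have [] := hf _ (inab _ yab).
  by rewrite mul0r => /eqP; rewrite subr_eq0 => /eqP.
have e0 : 0 < e by exact: le_lt_trans hx.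
have hz : `|z - z| < e by rewrite subrr normr0.
by have [xz|zx|->] := ltgtP x z; [rewrite (h x z) | rewrite (h z x) |].
Qed.

(** The hypothesis on w, w1, w2 says that the second derivative of w^(-1/2)
    vanishes; k below is its first derivative. *)
Lemma inverse_sqrt_affine (w w1 w2 : R -> R) (z e : R) :
  (forall x, `|x - z| < e -> [/\ 0 < w x, is_derive x 1 w (w1 x),
     is_derive x 1 w1 (w2 x) & 3 * w1 x ^+ 2 - 2 * w x * w2 x = 0]) ->
  exists a b, forall x, `|x - z| < e -> (Num.sqrt (w x))^-1 = a * x + b.
Proof.
move=> H.
pose s x := Num.sqrt (w x).
pose k x := - w1 x / (2 * (w x * s x)).
have s0 x : `|x - z| < e -> s x != 0.
  by move=> /H [w0 _ _ _]; rewrite /s gt_eqF // sqrtr_gt0.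
have ds x : `|x - z| < e -> is_derive x 1 s (w1 x / (2 * s x)).
  by move=> /H [w0 dw _ _]; exact: is_derive1_sqrt_comp.
have ws x : `|x - z| < e -> w x = s x ^+ 2.
  by move=> /H [w0 _ _ _]; rewrite /s sqr_sqrtr // ltW.
have dh x : `|x - z| < e -> is_derive x 1 (fun x => (s x)^-1) (k x).
  move=> hx; apply: (is_derive_eq (is_derive1V (s0 _ hx) (ds _ hx))).
  by rewrite /k (ws x hx); field; exact: s0.
have dk x : `|x - z| < e -> is_derive x 1 k 0.
  move=> hx; have [w0 dw dw1 E] := H _ hx.
  have n0 : 2 * (w x * s x) != 0.
    by rewrite !mulf_eq0 !negb_or pnatr_eq0 /= (gt_eqF w0) s0.
  have dn : is_derive x 1 (fun x => 2 * (w x * s x))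
      (0 * (w x * s x) + 2 * (w1 x * s x + w x * (w1 x / (2 * s x)))).
    exact: (is_derive1M (is_derive_cst (2 : R) x 1) (is_derive1M dw (ds _ hx))).
  have dm : is_derive x 1 (fun x => - w1 x) (- w2 x) := is_deriveN dw1.
  rewrite /k.
  apply: (is_derive_eq
    (is_derive1_div (g := fun x => 2 * (w x * s x)) n0 dm dn)).
  have sx := s0 _ hx.
  have -> : w2 x = 3 * w1 x ^+ 2 / (2 * w x).
    have wn : w x != 0 by rewrite gt_eqF.
    have -> : 3 * w1 x ^+ 2 = 2 * w x * w2 x by lra.
    by field.
  by rewrite (ws x hx); field.
have kz x (hx : `|x - z| < e) : k x = k z := zero_derivative_const dk hx.
have dl x : `|x - z| < e -> is_derive x 1 (fun x => (s x)^-1 - (k z * x + 0)) 0.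
  move=> hx; apply: (is_derive_eq
    (is_derive1B (dh _ hx) (is_derive_affine (k z) 0 x))).
  by rewrite kz // subrr.
exists (k z), ((s z)^-1 - (k z * z + 0)) => x hx.
by rewrite -(zero_derivative_const dl hx) /s; ring.
Qed.

(** h is interpolated in x between its values at two points, which are affine
    in y. *)
Lemma biaffine (h : R -> R -> R) (u v e : R) : 0 < e ->
  (forall y, `|y - v| < e ->
     exists a b, forall x, `|x - u| < e -> h x y = a * x + b) ->
  (forall x, `|x - u| < e ->
     exists a b, forall y, `|y - v| < e -> h x y = a * y + b) ->
  exists A B C D, forall x y, `|x - u| < e -> `|y - v| < e ->
    h x y = A * x * y + B * x + C * y + D.
Proof.
move=> e0 H1 H2.
pose u1 := u + e / 2.
have hu : `|u - u| < e by rewrite subrr normr0.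
have hu1 : `|u1 - u| < e.
  by rewrite /u1 addrC addKr gtr0_norm; lra.
have [a0 [b0 E0]] := H2 _ hu; have [a1 [b1 E1]] := H2 _ hu1.
have en : e != 0 by rewrite gt_eqF.
(* 2 / e is the inverse of the distance from u to u1 *)
exists (2 / e * (a1 - a0)), (2 / e * (b1 - b0)),
  (a0 - 2 / e * u * (a1 - a0)), (b0 - 2 / e * u * (b1 - b0)) => x y hx hy.
have [a [b E]] := H1 _ hy.
have F0 : a * u + b = a0 * y + b0 by rewrite -E // -E0.
have F1 : a * u1 + b = a1 * y + b1 by rewrite -E // -E1.
have aE : a = 2 / e * ((a1 * y + b1) - (a0 * y + b0)).
  by rewrite -F0 -F1 /u1; field.
have bE : b = a0 * y + b0 - a * u by rewrite -F0; ring.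
by rewrite E // bE aE; ring.
Qed.

Lemma locally_bilinear (D : set (R * R)) G u v : open D -> smooth_on D G ->
  (forall p, D p -> 0 < G p) ->
  (forall p, D p -> flex G 0 p = 0 /\ flex G 1 p = 0) ->
  D (u, v) ->
  exists a b c d : R, \forall p \near (u, v),
    G p = 1 / (a * p.1 * p.2 + b * p.1 + c * p.2 + d) ^+ 2.
Proof.
move=> oD sG G0 fG Duv.
have [e e0 eD] := near_box oD Duv.
have [|y hy|x hx|a [b [c [d E]]]] :=
    @biaffine (fun x y => (Num.sqrt (G (x, y)))^-1) u v e => //.
- apply: (@inverse_sqrt_affine (fun x => G (x, y)) (fun x => partial 0 G (x, y))
    (fun x => partial 0 (partial 0 G) (x, y))) => x hx.
  have Dx := eD _ _ hx hy; split; first exact: G0.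
  + by apply: is_derive_fst; exact: (sG [::]).
  + by apply: is_derive_fst; exact: (sG [:: 0]).
  + by have [h _] := fG _ Dx; exact: h.
- apply: (@inverse_sqrt_affine (fun y => G (x, y)) (fun y => partial 1 G (x, y))
    (fun y => partial 1 (partial 1 G) (x, y))) => y hy.
  have Dx := eD _ _ hx hy; split; first exact: G0.
  + by apply: is_derive_snd; exact: (sG [::]).
  + by apply: is_derive_snd; exact: (sG [:: 1]).
  + by have [_ h] := fG _ Dx; exact: h.
exists a, b, c, d; apply/nbhs_ballP; exists e => //= -[x y] [/= hx hy].
rewrite /ball /= distrC in hx; rewrite /ball /= distrC in hy.
have Dx := eD _ _ hx hy; rewrite -E // exprVn sqr_sqrtr ?ltW ?G0 //.
by rewrite div1r invrK.
Qed.

Lemma partial_fst_eq (D : set (R * R)) G (k : R -> R) dk x y :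
  open D -> D (x, y) -> differentiable G (x, y) ->
  (forall t, D (t, y) -> G (t, y) = k t) -> is_derive x 1 k dk ->
  partial 0 G (x, y) = dk.
Proof.
move=> oD Dxy dG E hk.
rewrite -(is_derive1E (is_derive_fst dG)) -(is_derive1E hk).
by apply: near_derive1; apply: filterS (near_fst oD Dxy).
Qed.

Lemma partial_snd_eq (D : set (R * R)) G (k : R -> R) dk x y :
  open D -> D (x, y) -> differentiable G (x, y) ->
  (forall t, D (x, t) -> G (x, t) = k t) -> is_derive y 1 k dk ->
  partial 1 G (x, y) = dk.
Proof.
move=> oD Dxy dG E hk.
rewrite -(is_derive1E (is_derive_snd dG)) -(is_derive1E hk).
by apply: near_derive1; apply: filterS (near_snd oD Dxy).
Qed.

(** L = G^(-1/2) up to sign is affine in each variable, whence the first two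
    equalities; both mixed derivatives are -2 a / L^3 + 6 L_x L_y / L^4. *)
Lemma bilinear_defect_zero (D : set (R * R)) G (a b c d : R) :
  open D -> smooth_on D G ->
  let L x y := a * x * y + b * x + c * y + d in
  (forall x y, D (x, y) -> L x y != 0 /\ G (x, y) = 1 / L x y ^+ 2) ->
  forall p, D p -> [/\ flex G 0 p = 0, flex G 1 p = 0 &
    partial 1 (partial 0 G) p = partial 0 (partial 1 G) p].
Proof.
move=> oD sG L GE.
have Lx x y : L x y = (a * y + b) * x + (c * y + d) by rewrite /L; ring.
have Ly x y : L x y = (a * x + c) * y + (b * x + d) by rewrite /L; ring.
have G0 x y : D (x, y) -> partial 0 G (x, y) = - (2 * (a * y + b)) / L x y ^+ 3.
  move=> Dxy; have [L0 _] := GE _ _ Dxy; rewrite Lx in L0.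
  rewrite (@partial_fst_eq D G
    (fun t => 1 / ((a * y + b) * t + (c * y + d)) ^+ 2)
    _ x y oD Dxy (sG [::] _ Dxy) _
    (is_derive_affine_powerV 1 1 L0)) ?Lx ?mulr1 //.
  by move=> t /GE [_ ->]; rewrite Lx.
have G1 x y : D (x, y) -> partial 1 G (x, y) = - (2 * (a * x + c)) / L x y ^+ 3.
  move=> Dxy; have [L0 _] := GE _ _ Dxy; rewrite Ly in L0.
  rewrite (@partial_snd_eq D G
    (fun t => 1 / ((a * x + c) * t + (b * x + d)) ^+ 2)
    _ x y oD Dxy (sG [::] _ Dxy) _
    (is_derive_affine_powerV 1 1 L0)) ?Ly ?mulr1 //.
  by move=> t /GE [_ ->]; rewrite Ly.
case=> x y Dxy; have [L0 GL] := GE _ _ Dxy.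
have L0x := L0; have L0y := L0; rewrite Lx in L0x; rewrite Ly in L0y.
have G00 : partial 0 (partial 0 G) (x, y) = 6 * (a * y + b) ^+ 2 / L x y ^+ 4.
  rewrite (@partial_fst_eq D (partial 0 G)
    (fun t => - (2 * (a * y + b)) / ((a * y + b) * t + (c * y + d)) ^+ 3)
    _ x y oD Dxy (sG [:: 0] _ Dxy) _ (is_derive_affine_powerV _ 2 L0x)).
    by rewrite Lx; congr (_ / _); ring.
  by move=> t /G0 ->; rewrite Lx.
have G11 : partial 1 (partial 1 G) (x, y) = 6 * (a * x + c) ^+ 2 / L x y ^+ 4.
  rewrite (@partial_snd_eq D (partial 1 G)
    (fun t => - (2 * (a * x + c)) / ((a * x + c) * t + (b * x + d)) ^+ 3)
    _ x y oD Dxy (sG [:: 1] _ Dxy) _ (is_derive_affine_powerV _ 2 L0y)).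
    by rewrite Ly; congr (_ / _); ring.
  by move=> t /G1 ->; rewrite Ly.
have mixed (al be k e t : R) : k * t + e != 0 ->
    is_derive t 1 (fun t => (al * t + be) * (1 / (k * t + e) ^+ 3))
      (al / (k * t + e) ^+ 3 - 3 * k * (al * t + be) / (k * t + e) ^+ 4).
  move=> n0; apply: (is_derive_eq (is_derive1M (is_derive_affine al be t)
    (is_derive_affine_powerV 1 2 n0))).
  by field.
have G01 : partial 1 (partial 0 G) (x, y) =
    - 2 * a / L x y ^+ 3 + 6 * (a * y + b) * (a * x + c) / L x y ^+ 4.
  rewrite (@partial_snd_eq D (partial 0 G)
    (fun t => (- 2 * a * t + - 2 * b) *
              (1 / ((a * x + c) * t + (b * x + d)) ^+ 3))
    _ x y oD Dxy (sG [:: 0] _ Dxy) _ (mixed _ _ _ _ _ L0y)).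
    by rewrite Ly; field.
  move=> t Dt; rewrite (G0 _ _ Dt) Ly; have [h _] := GE _ _ Dt.
  by rewrite Ly in h; field.
have G10 : partial 0 (partial 1 G) (x, y) =
    - 2 * a / L x y ^+ 3 + 6 * (a * y + b) * (a * x + c) / L x y ^+ 4.
  rewrite (@partial_fst_eq D (partial 1 G)
    (fun t => (- 2 * a * t + - 2 * c) *
              (1 / ((a * y + b) * t + (c * y + d)) ^+ 3))
    _ x y oD Dxy (sG [:: 1] _ Dxy) _ (mixed _ _ _ _ _ L0x)).
    by rewrite Lx; field.
  move=> t Dt; rewrite (G1 _ _ Dt) Lx; have [h _] := GE _ _ Dt.
  by rewrite Lx in h; field.
rewrite /flex G00 G11 G01 G10 (G0 _ _ Dxy) (G1 _ _ Dxy) GL.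
by split=> //; field.
Qed.

End Local.

(** * Bilinear forms in homogeneous coordinates *)

Section BilinearForms.
Context {R : realType}.
Implicit Types (X Y : R * R) (i j : chart).

Definition form (a b c d : R) X Y : R :=
  a * X.1 * Y.1 + b * X.1 * Y.2 + c * X.2 * Y.1 + d * X.2 * Y.2.

Lemma quadratic_near_zero (u c0 c1 c2 : R) :
  (\forall x \near u, c0 + c1 * x + c2 * x ^+ 2 = 0) ->
  [/\ c0 = 0, c1 = 0 & c2 = 0].
Proof.
move=> /nbhs_ballP [e /= e0 eP].
pose t := e / 2.
have t0 : t != 0 by rewrite /t gt_eqF // divr_gt0.
have hu : c0 + c1 * u + c2 * u ^+ 2 = 0 by apply: eP; exact: ballxx.
have hp : c0 + c1 * (u + t) + c2 * (u + t) ^+ 2 = 0.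
  by apply: eP; rewrite -ball_normE /= opprD addNKr normrN gtr0_norm /t; lra.
have hm : c0 + c1 * (u - t) + c2 * (u - t) ^+ 2 = 0.
  by apply: eP; rewrite -ball_normE /= subKr gtr0_norm /t; lra.
have h2 : c2 * t ^+ 2 = 0 by lra.
have z2 : c2 = 0.
  by move/eqP: h2; rewrite mulf_eq0 expf_eq0 /= (negbTE t0) orbF => /eqP.
rewrite z2 in hu hp.
have h1 : c1 * t = 0 by lra.
have z1 : c1 = 0.
  by move/eqP: h1; rewrite mulf_eq0 (negbTE t0) orbF => /eqP.
by rewrite z1 in hu; split=> //; lra.
Qed.

Lemma biquadratic_near_zero (u v c00 c01 c02 c10 c11 c12 c20 c21 c22 : R) :
  (\forall p \near (u, v),
    (c00 + c01 * p.2 + c02 * p.2 ^+ 2)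
    + (c10 + c11 * p.2 + c12 * p.2 ^+ 2) * p.1
    + (c20 + c21 * p.2 + c22 * p.2 ^+ 2) * p.1 ^+ 2 = 0) ->
  [/\ c00 = 0, c01 = 0 & c02 = 0] /\ [/\ c10 = 0, c11 = 0 & c12 = 0] /\
  [/\ c20 = 0, c21 = 0 & c22 = 0].
Proof.
move=> /nbhs_ballP [e /= e0 eP].
have H y : ball v e y -> [/\ c00 + c01 * y + c02 * y ^+ 2 = 0,
    c10 + c11 * y + c12 * y ^+ 2 = 0 & c20 + c21 * y + c22 * y ^+ 2 = 0].
  move=> hy; apply: (@quadratic_near_zero u).
  apply/nbhs_ballP; exists e => //= x hx.
  by apply: (eP (x, y)); split.
have hb : \forall y \near v, ball v e y by apply/nbhs_ballP; exists e.
by split; [|split]; apply: (@quadratic_near_zero v);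
  apply: filterS hb => y /H [].
Qed.

(** Equality of forms up to sign, in the shape in which it is used: the two
    forms define the same metric. *)
Definition same_square (a b c d a' b' c' d' : R) :=
  forall X Y, form a b c d X Y ^+ 2 = form a' b' c' d' X Y ^+ 2.

(** The nine coefficients of the square determine it; b c and a d enter only
    through their sum. *)
Lemma same_square_coef (a b c d a' b' c' d' : R) :
  [/\ a ^+ 2 = a' ^+ 2, b ^+ 2 = b' ^+ 2,
      c ^+ 2 = c' ^+ 2 & d ^+ 2 = d' ^+ 2] ->
  [/\ a * b = a' * b', a * c = a' * c', b * d = b' * d', c * d = c' * d' &
      a * d + b * c = a' * d' + b' * c'] ->
  same_square a b c d a' b' c' d'.
Proof.
move=> [ea eb ec ed] [eab eac ebd ecd eadbc] X Y.
have E (p q r s : R) : form p q r s X Y ^+ 2 =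
    p ^+ 2 * (X.1 ^+ 2 * Y.1 ^+ 2) + q ^+ 2 * (X.1 ^+ 2 * Y.2 ^+ 2)
    + r ^+ 2 * (X.2 ^+ 2 * Y.1 ^+ 2) + s ^+ 2 * (X.2 ^+ 2 * Y.2 ^+ 2)
    + 2 * ((p * q) * (X.1 ^+ 2 * Y.1 * Y.2) + (p * r) * (X.1 * X.2 * Y.1 ^+ 2)
    + (q * s) * (X.1 * X.2 * Y.2 ^+ 2) + (r * s) * (X.2 ^+ 2 * Y.1 * Y.2)
    + (p * s + q * r) * (X.1 * X.2 * Y.1 * Y.2)).
  by rewrite /form; ring.
by rewrite !E ea eb ec ed eab eac ebd ecd eadbc.
Qed.

(** The coefficients (A, B, C, D) of a form read in affine coordinates, as
    A u v + B u + C v + D; in each pair of charts they are the homogeneous ones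
    up to order and sign. *)
Definition chart_coefs i j (a b c d : R) : R * R * R * R :=
  match i, j with
  | AtFinite, AtFinite => (a, b, c, d)
  | AtInfinity, AtFinite => (c, d, - a, - b)
  | AtFinite, AtInfinity => (b, - a, d, - c)
  | AtInfinity, AtInfinity => (d, - c, - b, a)
  end.

Lemma form_chart i j (a b c d u v : R) :
  form a b c d (homog i u) (homog j v) =
  let: (A, B, C, D) := chart_coefs i j a b c d in A * u * v + B * u + C * v + D.
Proof. by rewrite /form; case: i; case: j => /=; ring. Qed.

Lemma chart_coefs_surj i j (A B C D : R) :
  exists a b c d, chart_coefs i j a b c d = (A, B, C, D).
Proof.
case: i; case: j; [exists A, B, C, D | exists (- B), A, (- D), C |
  exists (- C), (- D), A, B | exists D, (- C), (- B), A]; by rewrite /= ?opprK.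
Qed.

(** Read in the charts, both squares are biquadratic polynomials; agreeing on a
    box they have the same nine coefficients. *)
Lemma near_same_square i j (a b c d a' b' c' d' u v : R) :
  (\forall p \near (u, v), form a b c d (homog i p.1) (homog j p.2) ^+ 2 =
     form a' b' c' d' (homog i p.1) (homog j p.2) ^+ 2) ->
  same_square a b c d a' b' c' d'.
Proof.
have coefs (A B C D A' B' C' D' : R) :
    (\forall p \near (u, v), (A * p.1 * p.2 + B * p.1 + C * p.2 + D) ^+ 2 =
      (A' * p.1 * p.2 + B' * p.1 + C' * p.2 + D') ^+ 2) ->
  [/\ A ^+ 2 = A' ^+ 2, B ^+ 2 = B' ^+ 2,
      C ^+ 2 = C' ^+ 2 & D ^+ 2 = D' ^+ 2] /\
  [/\ A * B = A' * B', A * C = A' * C', B * D = B' * D', C * D = C' * D' &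
      A * D + B * C = A' * D' + B' * C'].
  move=> h.
  have [] := @biquadratic_near_zero u v
    (D ^+ 2 - D' ^+ 2) (2 * (C * D - C' * D')) (C ^+ 2 - C' ^+ 2)
    (2 * (B * D - B' * D')) (2 * (A * D + B * C - (A' * D' + B' * C')))
    (2 * (A * C - A' * C'))
    (B ^+ 2 - B' ^+ 2) (2 * (A * B - A' * B')) (A ^+ 2 - A' ^+ 2).
    apply: filterS h => -[x y] /= /eqP; rewrite -subr_eq0 => /eqP h.
    by rewrite -[RHS]h; ring.
  move=> [h00 h01 h02] [[h10 h11 h12] [h20 h21 h22]].
  have z (x : R) : 2 * x = 0 -> x = 0.
    by move=> /eqP; rewrite mulf_eq0 pnatr_eq0 => /eqP.
  by do !split; apply/eqP; rewrite -subr_eq0; apply/eqP => //; exact: z.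
move=> h.
have {}h : \forall p \near (u, v),
    (let: (A, B, C, D) := chart_coefs i j a b c d in
     A * p.1 * p.2 + B * p.1 + C * p.2 + D) ^+ 2 =
    (let: (A, B, C, D) := chart_coefs i j a' b' c' d' in
     A * p.1 * p.2 + B * p.1 + C * p.2 + D) ^+ 2.
  by apply: filterS h => p; rewrite !form_chart.
by case: i h; case: j => /= /coefs [[h1 h2 h3 h4] [k1 k2 k3 k4 k5]];
  rewrite ?sqrrN ?mulrNN in h1 h2 h3 h4 k1 k2 k3 k4 k5;
  apply: same_square_coef; split => //; lra.
Qed.

Lemma bilinear_metricE (a b c d : R) i j p :
  bilinear_metric a b c d i j p =
  1 / form a b c d (homog i p.1) (homog j p.2) ^+ 2.
Proof. by []. Qed.

(** A change of chart multiplies the homogeneous coordinates by a factor whose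
    square is the derivative of the change; this is the tensor law of
    [bilinear_metric] in one variable. *)
Lemma chart_change i i' (u : R) : in_chart i' (chart_point i u) ->
  exists2 l : R, l != 0 &
    (homog i' (transition i i' u) = (l * (homog i u).1, l * (homog i u).2)) /\
    derive1 (transition i i') u = l ^+ 2.
Proof.
have same (k : chart) : derive1 (transition k k) u = 1 :> R.
  rewrite (_ : transition k k = id); first by rewrite derive1_id.
  by apply/funext => x; exact: chart_pointK.
have swap (k k' : chart) : k <> k' -> transition k k' = fun x : R => - x^-1.
  case: k; case: k' => // _; apply/funext => x; rewrite /transition //=.
  by case: eqP => [->|//]; rewrite invr0 oppr0.
have dinv : u != 0 -> derive1 (fun x : R => - x^-1) u = (- u^-1) ^+ 2.
  move=> u0; have dV := is_derive1V (f := id) u0 (is_derive_id u 1).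
  have dN : is_derive u 1 (fun x : R => - x^-1) (- (- 1 / u ^+ 2)).
    exact: (is_deriveN dV).
  by rewrite (is_derive1E dN); field.
case: i; case: i' => h; rewrite /= in h.
- by exists 1; rewrite ?oner_eq0 // same expr1n !mul1r.
- have u0 : u != 0 by apply: contra_notN h => /eqP ->.
  exists (- u^-1); first by rewrite oppr_eq0 invr_eq0.
  by rewrite swap // dinv //; split; rewrite // mulr1 mulNr mulVf.
- have u0 : u != 0 by apply: contra_notN h => /eqP ->; rewrite eqxx.
  exists u^-1; first by rewrite invr_eq0.
  rewrite swap // dinv //; split.
  - by rewrite mulrN1 mulVf.
  - by rewrite sqrrN.
- by exists 1; rewrite ?oner_eq0 // same expr1n !mul1r /transition chart_pointK.
Qed.

Lemma bilinear_metric_change (a b c d : R) i j i' j' (u v : R) :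
  in_chart i' (chart_point i u) -> in_chart j' (chart_point j v) ->
  bilinear_metric a b c d i j (u, v) =
  bilinear_metric a b c d i' j' (transition i i' u, transition j j' v)
    * derive1 (transition i i') u * derive1 (transition j j') v.
Proof.
move=> /chart_change [l l0 [hX ->]] /chart_change [m m0 [hY ->]].
rewrite !bilinear_metricE /= hX hY.
have -> : form a b c d (l * (homog i u).1, l * (homog i u).2)
    (m * (homog j v).1, m * (homog j v).2) =
    l * m * form a b c d (homog i u) (homog j v).
  by rewrite /form /=; ring.
rewrite !exprMn; move: (form _ _ _ _ _ _) => q.
have [->|q0] := eqVneq q 0.
  by rewrite expr0n /= !mulr0 invr0 !(mulr0, mul0r).
by field; rewrite l0 m0 q0.
Qed.

End BilinearForms.

(** * From local to global *)

Section Gluing.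
Context {R : realType} (U : set (RP1 R * RP1 R)).
Context (g : chart -> chart -> R * R -> R).
Context (oU : open U) (gU : lorentz_metric U g).

(** All charts around [q] at once, so that the condition depends only on the
    point. *)
Definition bilinear_at (a b c d : R) (q : RP1 R * RP1 R) : Prop :=
  forall i j p, (chart_point i p.1, chart_point j p.2) = q ->
    g i j p = bilinear_metric a b c d i j p.

(** The tensor law, for the metric and for the form, carries the equality from
    one pair of charts to the others. *)
Lemma bilinear_at_near (a b c d u v : R) i j : coord_domain U i j (u, v) ->
  (\forall p \near (u, v), g i j p = bilinear_metric a b c d i j p) ->
  \forall q \near (chart_point i u, chart_point j v), bilinear_at a b c d q.
Proof.
move=> Uuv h; have [_ _ law] := gU.
set q0 := (chart_point i u, chart_point j v).
have hi : \forall q \near q0, in_chart i q.1.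
  have := near_in_chart (in_chart_point i u); exact: (@cvg_fst _ _ _ _ _).
have hj : \forall q \near q0, in_chart j q.2.
  have := near_in_chart (in_chart_point j v); exact: (@cvg_snd _ _ _ _ _).
have hU : \forall q \near q0, U q by exact: open_nbhs_nbhs.
have c1 : {for q0, continuous (fun q : RP1 R * RP1 R => chart_coord i q.1)}.
  apply: (@continuous_comp _ _ _ fst (@chart_coord R i)); first exact: cvg_fst.
  by apply: chart_coord_continuous; exact: in_chart_point.
have c2 : {for q0, continuous (fun q : RP1 R * RP1 R => chart_coord j q.2)}.
  apply: (@continuous_comp _ _ _ snd (@chart_coord R j)); first exact: cvg_snd.
  by apply: chart_coord_continuous; exact: in_chart_point.
have hg : \forall q \near q0, g i j (chart_coord i q.1, chart_coord j q.2) =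
    bilinear_metric a b c d i j (chart_coord i q.1, chart_coord j q.2).
  have h' : nbhs (chart_coord i q0.1, chart_coord j q0.2)
    [set p | g i j p = bilinear_metric a b c d i j p].
    by rewrite /q0 /= !chart_pointK.
  exact: (cvg_pair c1 c2 h').
near=> q => i' j' [x y] /= qE.
have q1 : chart_point i' x = q.1 by rewrite -qE.
have q2 : chart_point j' y = q.2 by rewrite -qE.
have Uq : U q by near: q.
have iq : in_chart i (chart_point i' x) by rewrite q1; near: q.
have jq : in_chart j (chart_point j' y) by rewrite q2; near: q.
rewrite (law i' j' i j x y) //; last by rewrite /coord_domain /= qE.
rewrite (bilinear_metric_change _ _ _ _ iq jq) /transition q1 q2.
by congr (_ * _ * _); near: q.
Unshelve. all: by end_near. Qed.

Lemma bilinear_at_same_square (a b c d a' b' c' d' : R) q : U q ->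
  (\forall r \near q, bilinear_at a b c d r) ->
  (\forall r \near q, bilinear_at a' b' c' d' r) ->
  same_square a b c d a' b' c' d'.
Proof.
case: q => q1 q2 Uq h h'.
have [i iq] := chart_cover q1; have [j jq] := chart_cover q2.
have [_ g0 _] := gU.
have qE : (chart_point i (chart_coord i q1),
           chart_point j (chart_coord j q2)) = (q1, q2).
  by rewrite !chart_coordK.
apply: (near_same_square (i := i) (j := j) (u := chart_coord i q1)
  (v := chart_coord j q2)).
have pull (P : set (RP1 R * RP1 R)) : nbhs (q1, q2) P ->
    \forall p \near (chart_coord i q1, chart_coord j q2),
      P (chart_point i p.1, chart_point j p.2).
  rewrite -qE => hP.
  exact: (@continuous_chart_points R i j (chart_coord i q1, chart_coord j q2)).
have hU : nbhs (q1, q2) U by exact: open_nbhs_nbhs.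
near=> p.
have gp : 0 < g i j p.
  by apply: g0; rewrite /coord_domain /=; near: p; exact: pull.
have e : g i j p = bilinear_metric a b c d i j p.
  have : bilinear_at a b c d (chart_point i p.1, chart_point j p.2).
    by near: p; exact: pull.
  by apply.
have e' : g i j p = bilinear_metric a' b' c' d' i j p.
  have : bilinear_at a' b' c' d' (chart_point i p.1, chart_point j p.2).
    by near: p; exact: pull.
  by apply.
rewrite bilinear_metricE div1r in e; rewrite bilinear_metricE div1r in e'.
by apply: invr_inj; rewrite -e -e'.
Unshelve. all: by end_near. Qed.

Lemma bilinear_at_transport (a b c d a' b' c' d' : R) q :
  same_square a b c d a' b' c' d' ->
  bilinear_at a b c d q -> bilinear_at a' b' c' d' q.
Proof.
move=> h hq i j p /hq ->; rewrite !bilinear_metricE.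
by rewrite h.
Qed.

Lemma near_near (T : topologicalType) (P : set T) (q : T) :
  (\forall r \near q, P r) -> \forall r \near q, \forall s \near r, P s.
Proof. exact: nbhs_interior. Qed.

(** J is the set of points near which a form with another square is correct; it
    is open and, by uniqueness, it is the complement in U of the open set I. *)
Lemma bilinear_everywhere : connected U -> U !=set0 ->
  (forall q, U q ->
     exists a b c d, \forall r \near q, bilinear_at a b c d r) ->
  exists a b c d, forall q, U q -> bilinear_at a b c d q.
Proof.
move=> cU [q0 U0] loc.
have [a [b [c [d h0]]]] := loc _ U0.
exists a, b, c, d.
pose I := [set q : RP1 R * RP1 R | \forall r \near q, bilinear_at a b c d r].
pose J : set (RP1 R * RP1 R) := fun q => exists a' b' c' d',
  (~ same_square a' b' c' d' a b c d) /\
  (\forall r \near q, bilinear_at a' b' c' d' r).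
have oI : open I by rewrite openE => q; exact: near_near.
have oJ : open J.
  rewrite openE => q [a' [b' [c' [d' [hn hq]]]]].
  apply: filterS (near_near hq) => r hr.
  by exists a', b', c', d'.
suff IU : U `&` I = U.
  by move=> q; rewrite -{1}IU => -[_ /nbhs_singleton].
apply: cU.
- by exists q0.
- by exists I.
- exists (~` J); first exact: open_closedC.
  apply/seteqP; split=> q [Uq]; last first.
    move=> nJ; split=> //.
    have [a' [b' [c' [d' h]]]] := loc _ Uq.
    have [hs|hn] := pselect (same_square a' b' c' d' a b c d).
      by apply: filterS h => r; exact: bilinear_at_transport.
    by exfalso; apply: nJ; exists a', b', c', d'.
  move=> Iq; split=> // -[a' [b' [c' [d' [hn h]]]]].
  by apply: hn; exact: (bilinear_at_same_square Uq h Iq).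
Qed.

End Gluing.

Theorem theorem1 (R : realType) (U : set (RP1 R * RP1 R))
  (Uopen : open U) (Udense : dense U) (Uconn : connected U)
  (g : chart -> chart -> R * R -> R) (gU : lorentz_metric U g) :
  (forall f : RP1 R -> RP1 R, diffeomorphism f -> orientation_preserving f ->
     curvature_schwarzian_identity U g f)
  <->
  (exists a b c d : R, ~ (a = 0 /\ b = 0 /\ c = 0 /\ d = 0) /\
     forall (i j : chart) (p : R * R), coord_domain U i j p ->
       g i j p = bilinear_metric a b c d i j p).
Proof.
have [sg g0 _] := gU.
split=> [H|[a [b [c [d [_ gE]]]]] f df opf i j u Uu fj].
- have [q0 Uq0] : U !=set0.
    have [q [_ Uq]] : [set: RP1 R * RP1 R] `&` U !=set0.
      by apply: Udense; [exists (None, None) | exact: openT].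
    by exists q.
  have [q Uq|a [b [c [d hE]]]] :=
      bilinear_everywhere Uopen gU Uconn (ex_intro _ q0 Uq0).
    case: q Uq => q1 q2 Uq.
    have [i iq] := chart_cover q1; have [j jq] := chart_cover q2.
    have Duv : coord_domain U i j (chart_coord i q1, chart_coord j q2).
      by rewrite /coord_domain /= !chart_coordK.
    have flat p : coord_domain U i j p ->
        flex (g i j) 0 p = 0 /\ flex (g i j) 1 p = 0.
      by case: p => x y; exact: flex_zero.
    have [A [B [C [D hn]]]] := locally_bilinear
      (@open_coord_domain _ U i j Uopen) (sg i j) (g0 i j) flat Duv.
    have [a [b [c [d abcd]]]] := chart_coefs_surj i j A B C D.
    exists a, b, c, d.
    rewrite -[q1](chart_coordK iq) -[q2](chart_coordK jq).
    apply: (bilinear_at_near Uopen gU Duv); apply: filterS hn => -[x y] -> .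
    by rewrite bilinear_metricE form_chart abcd.
  exists a, b, c, d; split; last by move=> i j p Dp; exact: (hE _ Dp).
  move=> [a0 [b0 [c0 d0]]].
  case: q0 Uq0 => q1 q2 Uq.
  have [i iq] := chart_cover q1; have [j jq] := chart_cover q2.
  have Duv : coord_domain U i j (chart_coord i q1, chart_coord j q2).
    by rewrite /coord_domain /= !chart_coordK.
  have := g0 _ _ _ Duv; rewrite (hE _ Duv i j _ erefl) bilinear_metricE.
  by rewrite a0 b0 c0 d0 /form !mul0r !addr0 expr0n invr0 mulr0 ltxx.
- apply/eqP; rewrite -subr_eq0; apply/eqP.
  rewrite (chart_defect Uopen gU df opf Uu fj).
  have [A [B [C [D abcd]]]] : exists A B C D,
      chart_coefs i j a b c d = (A, B, C, D).
    by case: (chart_coefs _ _ _ _ _ _) => [[[A B] C] D]; exists A, B, C, D.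
  have Dp : coord_domain U i j (u, local_expr f i j u).
    by rewrite /coord_domain /= /local_expr chart_coordK.
  have [|-> -> ->] := @bilinear_defect_zero _ _ (g i j) A B C D
    (@open_coord_domain _ U i j Uopen) (sg i j) _ _ Dp; last first.
    by rewrite subrr !mulr0 !subr0 mul0r.
  move=> x y Dxy; have gp := g0 _ _ _ Dxy.
  have E := gE _ _ _ Dxy; rewrite bilinear_metricE form_chart abcd in E.
  split=> //; apply: contraTneq gp => L0.
  by rewrite E L0 expr0n invr0 mulr0 ltxx.
Qed.
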